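(* For positive integers $k\le n$, $\theta_k(\ell_2,\ell_2)=\left(\frac{n}{k}\right)^{k/2}$, i.e. $\max\{\|C_k(B)\|_2 : B\in\mathbb{C}^{n\times n},\ \|\mathrm{col}_i(B)\|_2=1,\ i=1,\ldots,n\}=(n/k)^{k/2}$. Furthermore, if $A\in\mathbb{C}^{n\times n}$ is nonsingular and $k<n$, then $$\|C_k(A)\|_2 < \left(\frac{n}{k}\right)^{k/2}\max_{\alpha\subseteq\{1,\ldots,n\},\ |\alpha|=k}\ \prod_{i\in\alpha}\|\mathrm{col}_i(A)\|_2.$$
   Context: $C_k(B)$ is the $k$th compound of $B$: the $\binom nk\times\binom nk$ matrix of all $k\times k$ minors $\det B(\alpha|\beta)$, indexed by $k$-subsets $\alpha,\beta$ of $\{1,\ldots,n\}$. $\mathrm{col}_i(B)$ is the $i$th column of $B$. For vectors $\|\cdot\|_2$ is the Euclidean norm; for matrices it is the induced operator (spectral) norm. $\theta_k(\mu,\nu)$ denotes $\max\{\mu(C_k(B)): \nu(\mathrm{col}_i(B))=1\ \forall i\}$. *)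

(* Defs.v *)
From HB Require Import structures.
From mathcomp Require Import all_boot all_order all_algebra.
From mathcomp Require Import complex.
From mathcomp Require Import classical_sets reals.
Set Implicit Arguments. Unset Strict Implicit. Unset Printing Implicit Defensive.
Import Order.TTheory GRing.Theory Num.Theory.
Local Open Scope ring_scope.
Local Open Scope classical_set_scope.

Definition csqmod (R : realType) (z : R[i]) : R :=
  (complex.Re z) ^+ 2 + (complex.Im z) ^+ 2.

Definition vnorm (R : realType) (m : nat) (v : 'cV[R[i]]_m) : R :=
  Num.sqrt (\sum_(i < m) csqmod (v i 0)).

Definition specnorm (R : realType) (m p : nat) (A : 'M[R[i]]_(m, p)) : R :=
  sup [set vnorm (A *m x) | x in [set x : 'cV[R[i]]_p | vnorm x = 1]].

Definition ksub (n k : nat) := {A : {set 'I_n} | #|A| == k}.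

(* the increasing enumeration 'I_k -> alpha of a k-subset alpha *)
Definition ksub_elt (n k : nat) (a : ksub n k) (i : 'I_k) : 'I_n :=
  enum_val (cast_ord (esym (eqP (valP a))) i).

Definition minor (R : realType) (n k : nat) (B : 'M[R[i]]_n)
  (a b : ksub n k) : R[i] :=
  \det (\matrix_(i < k, j < k) B (ksub_elt a i) (ksub_elt b j)).

Definition compound (R : realType) (n k : nat) (B : 'M[R[i]]_n)
  : 'M[R[i]]_#|{: ksub n k}| :=
  \matrix_(i, j) minor B (enum_val i) (enum_val j).

(* Main.v *)
Require Import Defs.
From HB Require Import structures.
From mathcomp Require Import all_boot all_order all_algebra.
From mathcomp Require Import complex.
From mathcomp Require Import classical_sets reals.
From mathcomp Require Import perm spectral cyclic separable cyclotomic ring.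
Import Order.TTheory GRing.Theory Num.Theory.
Local Open Scope ring_scope.
Local Open Scope sesquilinear_scope.

(* By the spectral theorem for B^* B, write B = Q P with P unitary and the
   columns of Q orthogonal, of squared norms q_i with sum n.  Cauchy-Binet makes
   compounds multiplicative, so C_k(P) is unitary and C_k(Q)^* C_k(Q) is diagonal
   with entries the products of the q_i over k-subsets, which are at most
   (n/k)^k by AM-GM; when all q_i > 0 and k < n the proper partial sums are
   smaller than n, so this is strict.  Equality holds when B consists of k
   scaled rows of the Fourier matrix, for which B B^* is n/k times a rank k
   coordinate projection.  A general A is the product of a matrix with unit
   columns and the diagonal matrix of its column norms. *)

(** * Enumeration of k-subsets *)

Lemma ksub_elt_in {n k : nat} (a : ksub n k) (i : 'I_k) : ksub_elt a i \in val a.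
Proof. exact: enum_valP. Qed.

Lemma ksub_elt_inj {n k : nat} (a : ksub n k) : injective (ksub_elt a).
Proof. by move=> i j /enum_val_inj /cast_ord_inj. Qed.

Lemma ksub_elt_onto {n k : nat} (a : ksub n k) (x : 'I_n) :
  x \in val a -> exists i, ksub_elt a i = x.
Proof.
move=> ax; exists (cast_ord (eqP (valP a)) (enum_rank_in ax x)).
by rewrite /ksub_elt cast_ordK enum_rankK_in.
Qed.

Lemma ksub_elt_image {n k : nat} (a : ksub n k) :
  [set ksub_elt a i | i in 'I_k]%SET = val a.
Proof.
apply/setP => x; apply/imsetP/idP => [[i _ ->]|/ksub_elt_onto [i <-]].
  exact: ksub_elt_in.
by exists i.
Qed.

Lemma prod_ksub_elt {S : comPzSemiRingType} {n k : nat} (a : ksub n k)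
    (F : 'I_n -> S) :
  \prod_i F (ksub_elt a i) = \prod_(x in val a) F x.
Proof.
rewrite -[in RHS](ksub_elt_image a) big_imset //=.
by move=> i j _ _; apply: ksub_elt_inj.
Qed.

(** The subset is the image of [f], and [s] records the rank of each value of [f] within it. *)
Lemma injective_ksub_perm {n k : nat} (f : 'I_k -> 'I_n) : injective f ->
  exists (a : ksub n k) (s : 'S_k), forall i, f i = ksub_elt a (s i).
Proof.
move=> f_inj.
have card_f : #|[set f i | i in 'I_k]%SET| == k by rewrite card_imset ?card_ord.
pose a : ksub n k := Sub [set f i | i in 'I_k]%SET card_f.
have /fin_all_exists[g gP] i : exists j, ksub_elt a j = f i.
  by apply: ksub_elt_onto; rewrite SubK; apply/imsetP; exists i.
have g_inj : injective g by move=> i j gij; apply: f_inj; rewrite -!gP gij.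
by exists a, (perm g_inj) => i; rewrite permE gP.
Qed.

(** * Cauchy-Binet and the algebra of compounds *)

Lemma det_mulmx_ffun {S : comNzRingType} {n k : nat}
    (A : 'M[S]_(k, n)) (B : 'M[S]_(n, k)) :
  \det (A *m B) =
    \sum_(f : {ffun 'I_k -> 'I_n}) (\prod_i A i (f i)) * \det (rowsub f B).
Proof.
under [RHS]eq_bigr do rewrite mulr_sumr.
rewrite exchange_big; apply: eq_bigr => s _ /=.
under eq_bigr do rewrite mxE.
rewrite bigA_distr_bigA mulr_sumr; apply: eq_bigr => f _.
rewrite big_split mulrCA; congr (_ * (_ * _)).
by apply: eq_bigr => i _; rewrite mxE.
Qed.

(* The Cauchy-Binet formula: the non-injective [f] in [det_mulmx_ffun]
   contribute 0, and the injective ones factor as a permutation followed by the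
   enumeration of a k-subset. *)
Lemma det_mulmx_ksub {S : comNzRingType} {n k : nat}
    (A : 'M[S]_(k, n)) (B : 'M[S]_(n, k)) :
  \det (A *m B) =
    \sum_(c : ksub n k)
       \det (colsub (ksub_elt c) A) * \det (rowsub (ksub_elt c) B).
Proof.
rewrite det_mulmx_ffun (bigID (fun f : {ffun 'I_k -> 'I_n} => injectiveb f)) /=.
rewrite [X in _ + X]big1 ?addr0 => [|f /injectivePn[i [j ij fij]]]; last first.
  rewrite [\det _](determinant_alternate ij) ?mulr0 // => l.
  by rewrite !mxE fij.
pose h (p : ksub n k * 'S_k) : {ffun 'I_k -> 'I_n} :=
  [ffun i => ksub_elt p.1 (p.2 i)].
have h_inj : injective h.
  move=> [a s] [b t] /ffunP eq_h.
  have ab : a = b.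
    (* The subset is recovered from [h] as its image, since precomposing with a permutation leaves
       the image unchanged. *)
    apply: val_inj; rewrite -(ksub_elt_image a) -(ksub_elt_image b) /=.
    apply/setP => x; apply/imsetP/imsetP => -[i _ ->].
      by exists (t (s^-1%g i)) => //; have := eq_h (s^-1%g i); rewrite !ffunE /= permKV.
    by exists (s (t^-1%g i)) => //; have := eq_h (t^-1%g i); rewrite !ffunE /= permKV.
  rewrite -{b}ab in eq_h *; congr pair; apply/permP => i.
  by have := eq_h i; rewrite !ffunE => /ksub_elt_inj.
pose H := [set h p | p in [set: ksub n k * 'S_k]]%SET.
rewrite (eq_bigl (fun f => f \in H)); last first.
  move=> f; apply/injectiveP/imsetP => [/injective_ksub_perm[a [s fE]]|[[a s] _ ->]].
    by exists (a, s); rewrite ?inE //; apply/ffunP => i; rewrite ffunE fE.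
  by move=> i j; rewrite !ffunE => /ksub_elt_inj /perm_inj.
rewrite big_imset /=; last by move=> p q _ _; apply: h_inj.
under eq_bigl do rewrite inE.
under [RHS]eq_bigr do rewrite mulr_suml.
rewrite pair_bigA /=; apply: eq_bigr => -[c s] _ /=.
(* The sign from sorting the rows of [B] by [s] is the one attached to [s] in the Leibniz expansion
   of the minor of [A]. *)
have -> : rowsub (h (c, s)) B = row_perm s (rowsub (ksub_elt c) B).
  by apply/matrixP => i j; rewrite !mxE ffunE.
rewrite row_permE det_mulmx det_perm mulrA; congr (_ * _).
by rewrite mulrC; congr (_ * _); apply: eq_bigr => i _; rewrite !mxE ffunE.
Qed.

Lemma minor_mulmx {R : realType} {n k : nat} (A B : 'M[R[i]]_n) (a b : ksub n k) :
  minor (A *m B) a b = \sum_(c : ksub n k) minor A a c * minor B c b.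
Proof.
have -> : minor (A *m B) a b =
    \det (rowsub (ksub_elt a) A *m colsub (ksub_elt b) B).
  congr (\det _); apply/matrixP => i j; rewrite !mxE.
  by apply: eq_bigr => l _; rewrite !mxE.
rewrite det_mulmx_ksub; apply: eq_bigr => c _.
by rewrite /minor; congr (_ * _); congr (\det _); apply/matrixP => i j; rewrite !mxE.
Qed.

Lemma compound_mulmx {R : realType} {n k : nat} (A B : 'M[R[i]]_n) :
  compound k (A *m B) = compound k A *m compound k B.
Proof.
apply/matrixP => i j; rewrite !mxE minor_mulmx [LHS]big_enum_val.
by apply: eq_bigr => l _; rewrite !mxE.
Qed.

Lemma compound_trmxC {R : realType} {n k : nat} (A : 'M[R[i]]_n) :
  compound k (A^t*) = (compound k A)^t*.
Proof.
apply/matrixP => i j; rewrite !mxE /minor -det_map_mx -det_tr.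
by congr (\det _); apply/matrixP => r c; rewrite !mxE.
Qed.

Lemma minor_diag {R : realType} {n k : nat} (d : 'rV[R[i]]_n) (a b : ksub n k) :
  minor (diag_mx d) a b = (\prod_(x in val a) d 0 x) *+ (a == b).
Proof.
have [<-|neq_ab] := eqVneq a b.
  rewrite mulr1n -(prod_ksub_elt a (fun x => d 0 x)) /minor.
  have <- : diag_mx (\row_i d 0 (ksub_elt a i)) =
      \matrix_(i < k, j < k) diag_mx d (ksub_elt a i) (ksub_elt a j).
    apply/matrixP => i j; rewrite !mxE.
    by rewrite (inj_eq (@ksub_elt_inj _ _ a)).
  by rewrite det_diag; apply: eq_bigr => i _; rewrite mxE.
(* Distinct sets of equal size are not nested, so some [x] lies in [a] but not in [b]; the row of
   the minor indexed by [x] vanishes. *)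
have /subsetPn[x ax bx] : ~~ (val a \subset val b).
  apply: contra neq_ab => ab; rewrite -val_eqE eqEcard ab /=.
  by rewrite (eqP (valP a)) (eqP (valP b)).
have [i xE] := ksub_elt_onto a x ax.
rewrite /minor (expand_det_row _ i) big1 // => j _; rewrite !mxE xE.
suff /negPf-> : x != ksub_elt b j by rewrite mul0r.
by apply: contraNneq bx => ->; apply: ksub_elt_in.
Qed.

Lemma compound_diag {R : realType} {n k : nat} (d : 'rV[R[i]]_n) :
  compound k (diag_mx d) =
    diag_mx (\row_a \prod_(x in val (enum_val a : ksub n k)) d 0 x).
Proof.
apply/matrixP => i j; rewrite !mxE minor_diag.
by rewrite (inj_eq enum_val_inj).
Qed.

(** * The Euclidean norm on complex vectors *)

Lemma csqmod_ge0 {R : realType} (z : R[i]) : 0 <= csqmod z.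
Proof. by rewrite addr_ge0 ?sqr_ge0. Qed.

Lemma csqmodE {R : realType} (z : R[i]) : (csqmod z)%:C%C = Num.conj z * z.
Proof. by rewrite /csqmod add_Re2_Im2 normCK mulrC. Qed.

Lemma csqmodM {R : realType} (y z : R[i]) : csqmod (y * z) = csqmod y * csqmod z.
Proof.
by case: y => a b; case: z => c d; rewrite /csqmod /=; ring.
Qed.

Lemma vnorm_ge0 {R : realType} {m : nat} (v : 'cV[R[i]]_m) : 0 <= vnorm v.
Proof. exact: sqrtr_ge0. Qed.

Lemma sqr_vnorm {R : realType} {m : nat} (v : 'cV[R[i]]_m) :
  vnorm v ^+ 2 = \sum_i csqmod (v i 0).
Proof. by rewrite sqr_sqrtr // sumr_ge0 // => i _; apply: csqmod_ge0. Qed.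

Lemma sqr_vnormC {R : realType} {m : nat} (v : 'cV[R[i]]_m) :
  (vnorm v ^+ 2)%:C%C = (v^t* *m v) 0 0.
Proof.
rewrite sqr_vnorm rmorph_sum mxE; apply: eq_bigr => i _.
by rewrite !mxE -csqmodE.
Qed.

Lemma vnorm_eq0 {R : realType} {m : nat} (v : 'cV[R[i]]_m) :
  (vnorm v == 0) = (v == 0).
Proof.
apply/idP/eqP => [v0|->]; last first.
  by rewrite -sqrf_eq0 sqr_vnorm big1 // => i _; rewrite mxE /csqmod /= !expr0n addr0.
apply/matrixP => i j; rewrite (ord1 j) mxE.
have: csqmod (v i 0) == 0.
  move: v0; rewrite -sqrf_eq0 sqr_vnorm psumr_eq0; last by move=> *; exact: csqmod_ge0.
  by move=> /allP /(_ i); apply; rewrite mem_index_enum.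
rewrite -(inj_eq (@complexI _)) csqmodE mulf_eq0 conjC_eq0 orbb.
by move=> /eqP.
Qed.

Lemma vnormZ {R : realType} {m : nat} (c : R) (v : 'cV[R[i]]_m) :
  0 <= c -> vnorm (c%:C%C *: v) = c * vnorm v.
Proof.
move=> c_ge0; apply/eqP.
rewrite -(@eqrXn2 _ 2%N) ?mulr_ge0 ?vnorm_ge0 // exprMn !sqr_vnorm mulr_sumr.
apply/eqP; apply: eq_bigr => i _; rewrite mxE csqmodM.
by congr (_ * _); rewrite /csqmod /= expr0n addr0.
Qed.

Lemma gram_diagE {R : realType} {m n : nat} (Q : 'M[R[i]]_(m, n)) (i : 'I_n) :
  (Q^t* *m Q) i i = (vnorm (col i Q) ^+ 2)%:C%C.
Proof.
by rewrite sqr_vnormC !mxE; apply: eq_bigr => j _; rewrite !mxE.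
Qed.

(** * Orthogonalizing the columns, and AM-GM *)

Lemma unitary_factorization {R : realType} {n : nat} (B : 'M[R[i]]_n) :
  exists Q P : 'M[R[i]]_n, [/\ P \is unitarymx, B = Q *m P &
    Q^t* *m Q = diag_mx (\row_i (vnorm (col i Q) ^+ 2)%:C%C)].
Proof.
pose G := B^t* *m B; pose P := spectralmx G.
have P_unitary : P \is unitarymx by apply: spectral_unitarymx.
have G_normal : G \is normalmx.
  by apply/normalmxP; rewrite /G trmx_mul map_mxM trmxCK.
(* As [G] is the conjugate of a diagonal matrix by [P], the Gram matrix of [Q] is [P G P^*], which
   is diagonal. This is a singular value decomposition with the singular values left inside [Q]. *)
pose Q := B *m P^t*; exists Q, P; split=> //.
  by rewrite /Q mulmxKtV.
have Q_diag : Q^t* *m Q = diag_mx (spectral_diag G).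
  rewrite /Q trmx_mul map_mxM trmxCK mulmxA -(mulmxA P) -/G.
  rewrite [X in P *m X](orthomx_spectralP G_normal) -/P invmx_unitary // !mulmxA.
  by rewrite mulmxtVK // (unitarymxP P_unitary) mul1mx.
rewrite Q_diag; congr diag_mx; apply/rowP => i.
by rewrite mxE -gram_diagE Q_diag mxE eqxx mulr1n.
Qed.

Lemma prod_ksub_le {R : realType} {n k : nat} (q : 'I_n -> R) (a : ksub n k) :
  (0 < k)%N -> (forall i, 0 <= q i) ->
  \prod_(x in val a) q x <= ((\sum_i q i) / k%:R) ^+ k.
Proof.
move=> k_gt0 q_ge0.
have := leif_AGM (A := [in val a]) (fun i _ => q_ge0 i).
rewrite (eqP (valP a)) => -[AGM _]; apply: (le_trans AGM).
rewrite lerXn2r ?nnegrE ?divr_ge0 ?sumr_ge0 ?ler0n //.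
rewrite ler_wpM2r ?invr_ge0 ?ler0n // [leRHS](bigID [in val a]) /=.
by rewrite lerDl sumr_ge0.
Qed.

Lemma prod_ksub_lt {R : realType} {n k : nat} (q : 'I_n -> R) (a : ksub n k) :
  (0 < k)%N -> (k < n)%N -> (forall i, 0 < q i) ->
  \prod_(x in val a) q x < ((\sum_i q i) / k%:R) ^+ k.
Proof.
move=> k_gt0 k_lt_n q_gt0; have q_ge0 i : 0 <= q i by apply: ltW.
have := leif_AGM (A := [in val a]) (fun i _ => q_ge0 i).
rewrite (eqP (valP a)) => -[AGM _]; apply: (le_lt_trans AGM).
rewrite ltrXn2r ?nnegrE ?divr_ge0 ?sumr_ge0 ?ler0n ?andbT -?lt0n //.
rewrite ltr_pM2r ?invr_gt0 ?ltr0n // [ltRHS](bigID [in val a]) /=.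
(* An index outside [a] exists because [k < n]; its positive [q x] makes the sum over [a] strictly
   smaller than the full sum. *)
have /subsetPn[x _ ax] : ~~ ([set: 'I_n]%SET \subset val a).
  apply: contraL k_lt_n => /subset_leq_card.
  by rewrite cardsT card_ord (eqP (valP a)) leqNgt.
by rewrite ltrDl (bigD1 x) //= ltr_pwDl // sumr_ge0.
Qed.

(** Both sums are traces of Gram matrices, and the trace is invariant under cyclic permutation of
    factors. *)
Lemma sum_sqr_vnorm_unitary {R : realType} {n : nat} (Q P : 'M[R[i]]_n) :
  P \is unitarymx ->
  \sum_i vnorm (col i (Q *m P)) ^+ 2 = \sum_i vnorm (col i Q) ^+ 2.
Proof.
have trE (B : 'M[R[i]]_n) :
    (\sum_i vnorm (col i B) ^+ 2)%:C%C = \tr (B^t* *m B).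
  by rewrite rmorph_sum; apply: eq_bigr => i _; rewrite gram_diagE.
move=> P_unitary; apply: (@complexI _); rewrite !trE trmx_mul map_mxM mulmxA.
by rewrite mxtrace_mulC !mulmxA (unitarymxP P_unitary) mul1mx.
Qed.

(** The compound of [Q] has Gram matrix equal to the compound of the diagonal matrix [Q^* Q], so the
    squared norm is a weighted sum of squares. Keeping [q] abstract lets this serve unitary and
    diagonal matrices and adjoints as well. *)
Lemma sqr_vnorm_compound {R : realType} {n k : nat} (Q : 'M[R[i]]_n)
    (q : 'I_n -> R) (y : 'cV_#|{: ksub n k}|) :
  Q^t* *m Q = diag_mx (\row_i (q i)%:C%C) ->
  vnorm (compound k Q *m y) ^+ 2 =
    \sum_a (\prod_(x in val (enum_val a : ksub n k)) q x) * csqmod (y a 0).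
Proof.
move=> Q_diag; apply: (@complexI _).
rewrite sqr_vnormC trmx_mul map_mxM mulmxA -(mulmxA (y^t*)).
rewrite -compound_trmxC -compound_mulmx Q_diag compound_diag rmorph_sum mxE.
apply: eq_bigr => a _; rewrite mul_mx_diag !mxE rmorphM /= csqmodE rmorph_prod.
rewrite mulrAC mulrC; congr (_ * _).
by apply: eq_bigr => x _; rewrite mxE.
Qed.

Lemma vnorm_compound_le {R : realType} {n k : nat} (Q : 'M[R[i]]_n)
    (q : 'I_n -> R) (K : R) (y : 'cV_#|{: ksub n k}|) :
  Q^t* *m Q = diag_mx (\row_i (q i)%:C%C) -> 0 <= K ->
  (forall a : ksub n k, \prod_(x in val a) q x <= K ^+ 2) ->
  vnorm (compound k Q *m y) <= K * vnorm y.
Proof.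
move=> Q_diag K_ge0 q_le; rewrite -(@ler_pXn2r _ 2%N) ?nnegrE //; last 2 first.
- exact: vnorm_ge0.
- by rewrite mulr_ge0 ?vnorm_ge0.
rewrite exprMn (sqr_vnorm_compound _ _ _ Q_diag) sqr_vnorm mulr_sumr.
by apply: ler_sum => a _; rewrite ler_wpM2r ?csqmod_ge0.
Qed.

Lemma vnorm_compound_unitary {R : realType} {n k : nat} (P : 'M[R[i]]_n)
    (y : 'cV_#|{: ksub n k}|) :
  P \is unitarymx -> vnorm (compound k P *m y) <= vnorm y.
Proof.
move=> P_unitary; rewrite -[leRHS]mul1r.
apply: (vnorm_compound_le _ (fun=> 1)) => // [|a].
  rewrite (mulmx1C (unitarymxP P_unitary)).
  by apply/matrixP => i j; rewrite !mxE.
by rewrite big1 ?expr1n.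
Qed.

(** * The operator norm and the upper bound *)

Lemma specnorm_le {R : realType} {m p : nat} (A : 'M[R[i]]_(m, p)) (K : R) :
  0 <= K -> (forall x, vnorm (A *m x) <= K * vnorm x) -> specnorm A <= K.
Proof.
move=> K_ge0 A_le; rewrite /specnorm; set E := (X in sup X).
(* Without unit vectors ([p = 0]) the supremum is that of the empty set, 0 by convention; there
   [0 <= K] concludes. *)
have [->|/set0P E_neq0] := eqVneq E set0; first by rewrite sup0.
by apply: ge_sup => // _ [x x1 <-]; rewrite (le_trans (A_le x)) // x1 mulr1.
Qed.

(** The hypothesis bounds the set of values from above, so [sup] dominates each of them; a nonzero
    [x] is then normalized. *)
Lemma le_specnorm {R : realType} {m p : nat} (A : 'M[R[i]]_(m, p)) (K : R)
    (x : 'cV_p) :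
  (forall y, vnorm (A *m y) <= K * vnorm y) ->
  vnorm (A *m x) <= specnorm A * vnorm x.
Proof.
move=> A_le; have [->|x_neq0] := eqVneq x 0.
  have v0 q : vnorm (0 : 'cV[R[i]]_q) = 0 by apply/eqP; rewrite vnorm_eq0.
  by rewrite mulmx0 !v0 mulr0.
have x_gt0 : 0 < vnorm x by rewrite lt_def vnorm_ge0 vnorm_eq0 x_neq0.
rewrite -ler_pdivrMr // mulrC -vnormZ ?invr_ge0 ?vnorm_ge0 // scalemxAr.
apply: ub_le_sup.
  by exists K => _ [y y1 <-]; rewrite (le_trans (A_le y)) // y1 mulr1.
exists ((vnorm x)^-1%:C%C *: x) => //=.
by rewrite vnormZ ?invr_ge0 ?vnorm_ge0 // mulVf // gt_eqF.
Qed.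

Lemma unitmx_col_neq0 {F : comUnitRingType} {n : nat} (A : 'M[F]_n) (i : 'I_n) :
  A \in unitmx -> col i A != 0.
Proof.
apply: contraTneq => Ai0.
rewrite unitmxE -det_tr (expand_det_row _ i) big1 ?unitr0 // => j _.
by move: Ai0 => /matrixP /(_ j 0); rewrite !mxE => ->; rewrite mul0r.
Qed.

(** The bound is stated vector by vector so that it can be composed with another factor, and can
    also certify that the supremum in [specnorm] is over a bounded set. *)
Lemma compound_bound {R : realType} {n k : nat} (B : 'M[R[i]]_n) :
  (0 < k)%N -> (forall i, vnorm (col i B) = 1) ->
  exists K : R, [/\ 0 <= K, K <= Num.sqrt ((n%:R / k%:R) ^+ k),
    (B \in unitmx -> (k < n)%N -> K < Num.sqrt ((n%:R / k%:R) ^+ k)) &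
    forall y, vnorm (compound k B *m y) <= K * vnorm y].
Proof.
move=> k_gt0 B1; have [Q [P [P_unitary B_eq Q_diag]]] := unitary_factorization B.
pose q i := vnorm (col i Q) ^+ 2.
have q_ge0 i : 0 <= q i by apply: sqr_ge0.
have sum_q : \sum_i q i = n%:R.
  rewrite -(sum_sqr_vnorm_unitary Q P P_unitary) -B_eq.
  under eq_bigr do rewrite B1 expr1n.
  by rewrite sumr_const card_ord.
(* The largest eigenvalue of the Gram matrix of the compound of [Q]. Being a maximum over finitely
   many subsets, it inherits a strict bound from the individual products. *)
pose M := \big[Num.max/0]_(a : ksub n k) \prod_(x in val a) q x.
have M_ge0 : 0 <= M by apply: bigmax_ge_id.
exists (Num.sqrt M); split=> [||B_unit k_lt_n|y].
- exact: sqrtr_ge0.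
- rewrite ler_wsqrtr // bigmax_le ?exprn_ge0 ?divr_ge0 ?ler0n // => a _.
  by rewrite -sum_q prod_ksub_le.
- have n_gt0 : (0 < n)%N by apply: leq_ltn_trans k_lt_n.
  have bound_gt0 : 0 < (n%:R / k%:R) ^+ k :> R by rewrite exprn_gt0 ?divr_gt0 ?ltr0n.
  rewrite ltr_sqrt // bigmax_lt // => a _.
  rewrite -sum_q prod_ksub_lt // => i.
  (* If [B] is invertible then so is [Q], hence no column of [Q] is zero. *)
  rewrite exprn_gt0 // lt_def vnorm_ge0 vnorm_eq0 andbT unitmx_col_neq0 //.
  by move: B_unit; rewrite B_eq unitmx_mul => /andP[].
rewrite B_eq compound_mulmx -mulmxA.
apply: le_trans (_ : Num.sqrt M * vnorm (compound k P *m y) <= _).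
  apply: (vnorm_compound_le _ q) => // [|a]; first exact: sqrtr_ge0.
  by rewrite sqr_sqrtr //; apply: le_bigmax.
by rewrite ler_wpM2l ?sqrtr_ge0 ?vnorm_compound_unitary.
Qed.

(** * Roots of unity and the extremal matrix *)

Lemma closed_prim_root {F : numClosedFieldType} (n : nat) :
  (0 < n)%N -> exists z : F, n.-primitive_root z.
Proof.
move=> n_gt0; pose p : {poly F} := 'X^n - 1.
have [r p_eq] := closed_field_poly_normal p.
rewrite (monicP _) ?monicXnsubC // scale1r in p_eq.
have r_roots : all n.-unity_root r.
  by apply/allP => z; rewrite -root_prod_XsubC -p_eq.
have size_r : (n < (size r).+1)%N.
  by rewrite -(size_prod_XsubC r id) -p_eq size_XnsubC.
have [|z] := hasP (has_prim_root n_gt0 r_roots _ size_r); last by exists z.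
(* In characteristic 0 the polynomial [X^n - 1] is separable, so its [n] roots are distinct, as
   [has_prim_root] requires. *)
by rewrite -separable_prod_XsubC -p_eq separable_Xn_sub_1 // pnatr_eq0 -lt0n.
Qed.

Lemma norm_prim_root {F : numClosedFieldType} {n : nat} (z : F) :
  n.-primitive_root z -> `|z| = 1.
Proof.
move=> z_prim; apply/eqP; rewrite -(@pexpr_eq1 _ _ n) ?(prim_order_gt0 z_prim) //.
by rewrite -normrX prim_expr_order ?normr1.
Qed.

(** Orthogonality of the rows of the Fourier matrix: a geometric sum whose ratio [u] is an [n]-th
    root of unity, equal to 1 only when [i = j]. *)
Lemma sum_prim_root {F : numClosedFieldType} {n : nat} (z : F) (i j : 'I_n) :
  n.-primitive_root z ->
  \sum_(l < n) z ^+ (i * l) * Num.conj (z ^+ (j * l)) = n%:R *+ (i == j).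
Proof.
move=> z_prim; have z1 := norm_prim_root z z_prim.
have zX1 m : z ^+ m * Num.conj (z ^+ m) = 1 by rewrite -normCK normrX z1 !expr1n.
pose u := z ^+ i * Num.conj (z ^+ j).
have -> : \sum_(l < n) z ^+ (i * l) * Num.conj (z ^+ (j * l)) = \sum_(l < n) u ^+ l.
  by apply: eq_bigr => l _; rewrite !exprM (rmorphXn _ l) exprMn.
have [eq_ij|neq_ij] := eqVneq i j.
  rewrite /u -eq_ij zX1; under eq_bigr do rewrite expr1n.
  by rewrite sumr_const card_ord mulr1n.
have un1 : u ^+ n = 1.
  rewrite exprMn -rmorphXn /= -!exprM ![(_ * n)%N]mulnC !exprM.
  by rewrite (prim_expr_order z_prim) !expr1n rmorph1 mulr1.
have u_neq1 : u != 1.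
  apply: contra neq_ij => /eqP /(congr1 ( *%R^~ (z ^+ j))).
  rewrite mul1r -mulrA [X in _ * X]mulrC zX1 mulr1 => /eqP.
  by rewrite (eq_prim_root_expr z_prim) !modn_small.
have := subrX1 u n; rewrite un1 subrr => /esym/eqP.
by rewrite mulf_eq0 subr_eq0 (negPf u_neq1) => /eqP.
Qed.

Lemma card_ord_lt {n k : nat} : (k <= n)%N -> #|[set i : 'I_n | (i < k)%N]%SET| = k.
Proof.
move=> k_le_n.
have widen_inj : injective (widen_ord k_le_n).
  by move=> i j /(congr1 val) ?; apply: val_inj.
rewrite -[RHS]card_ord -(card_imset _ widen_inj).
congr #|pred_of_set _|; apply/setP => i; rewrite inE.
apply/idP/imsetP => [i_lt|[j _ ->]]; last exact: (ltn_ord j).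
by exists (Ordinal i_lt) => //; apply: val_inj.
Qed.

Lemma conjC_real_complex {R : realType} (r : R) : Num.conj r%:C%C = r%:C%C.
Proof. by apply/CrealP; apply/complex_realP; exists r. Qed.

Lemma unit_columns_tight_frame {R : realType} (n k : nat) :
  (0 < k)%N -> (k <= n)%N ->
  exists B : 'M[R[i]]_n, (forall i, vnorm (col i B) = 1) /\
    B *m B^t* =
      diag_mx (\row_i (if (i < k)%N then n%:R / k%:R else 0 : R)%:C%C).
Proof.
move=> k_gt0 k_le_n; have n_gt0 : (0 < n)%N by apply: leq_trans k_le_n.
have [z z_prim] := @closed_prim_root R[i] n n_gt0.
(* Each column will have exactly [k] nonzero entries, all of modulus [c], so this value makes the
   columns unit vectors. *)
pose c : R := Num.sqrt k%:R^-1.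
have c2 : c ^+ 2 = k%:R^-1 by rewrite sqr_sqrtr // invr_ge0 ler0n.
pose B : 'M[R[i]]_n :=
  \matrix_(i, j) ((if (i < k)%N then c else 0)%:C%C * z ^+ (i * j)).
exists B; split=> [j|].
  apply/eqP; rewrite -(@pexpr_eq1 _ _ 2%N) ?vnorm_ge0 // sqr_vnorm.
  have csqmod_B i : csqmod (col j B i 0) = if (i < k)%N then k%:R^-1 else 0.
    rewrite !mxE csqmodM.
    have -> : csqmod (z ^+ (i * j)) = 1.
      apply: (@complexI _).
      by rewrite /csqmod add_Re2_Im2 normrX (norm_prim_root z z_prim) !expr1n.
    by rewrite mulr1 /csqmod /= expr0n addr0; case: ifP; rewrite ?expr0n.
  under eq_bigr do rewrite csqmod_B.
  rewrite -big_mkcond /= sumr_const.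
  rewrite -[X in _ *+ X](_ : #|[set i : 'I_n | (i < k)%N]%SET| = _); last first.
    by apply: eq_card => i; rewrite inE.
  by rewrite card_ord_lt // -[eqbLHS]mulr_natl mulfV // pnatr_eq0 -lt0n.
apply/matrixP => i j; rewrite !mxE.
under eq_bigr => l _.
  rewrite !mxE rmorphM mulrACA /=.
  over.
rewrite -mulr_sumr (sum_prim_root z i j z_prim).
have [<-|_] := eqVneq i j; last by rewrite !mulr0n mulr0.
rewrite !mulr1n conjC_real_complex -(rmorph_nat (real_complex R) n) -!rmorphM.
by case: ifP => _; rewrite ?mulr0 ?mul0r // -expr2 c2 mulrC.
Qed.

(** * The lower bound and the strict inequality *)

Lemma le_specnorm_compound {R : realType} {n k : nat} (B : 'M[R[i]]_n)
    (q : 'I_n -> R) (a : ksub n k) (K : R) :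
  B *m B^t* = diag_mx (\row_i (q i)%:C%C) ->
  (forall y, vnorm (compound k B *m y) <= K * vnorm y) ->
  0 < \prod_(x in val a) q x ->
  Num.sqrt (\prod_(x in val a) q x) <= specnorm (compound k B).
Proof.
move=> B_diag B_le; set T := \prod_(x in _) _ => T_gt0.
pose e : 'cV[R[i]]_#|{: ksub n k}| := delta_mx (enum_rank a) 0.
have csqmod_e b : csqmod (e b 0) = (b == enum_rank a)%:R.
  by rewrite mxE eqxx andbT /csqmod; case: eqP => _; rewrite /= ?expr1n !expr0n addr0.
have sum_e (F : 'I_#|{: ksub n k}| -> R) : \sum_b F b * csqmod (e b 0) = F (enum_rank a).
  rewrite (bigD1 (enum_rank a)) //= csqmod_e eqxx mulr1 big1 ?addr0 // => b b_neq.
  by rewrite csqmod_e (negPf b_neq) mulr0.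
have vnorm_e : vnorm e = 1.
  apply/eqP; rewrite -(@pexpr_eq1 _ _ 2%N) ?vnorm_ge0 // sqr_vnorm.
  by under eq_bigr do rewrite -[csqmod _]mul1r; rewrite sum_e.
(* The test vector: the compound of [B B^*] is diagonal with entry [T] at [a], so [x] is sent to
   [T e], while [x] itself has squared norm [T]. The ratio of the norms is the square root of
   [T]. *)
pose x := compound k (B^t*) *m e.
have vnorm_x : vnorm x = Num.sqrt T.
  rewrite -[LHS]ger0_norm ?vnorm_ge0 // -sqrtr_sqr; congr Num.sqrt.
  rewrite (sqr_vnorm_compound _ q); last by rewrite trmxCK.
  by rewrite sum_e enum_rankK.
have vnorm_Bx : vnorm (compound k B *m x) = T.
  have -> : compound k B *m x = T%:C%C *: e.
    rewrite mulmxA -compound_mulmx B_diag compound_diag.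
    apply/matrixP => b j; rewrite (ord1 j) mul_diag_mx !mxE eqxx andbT.
    have [->|_] := eqVneq b (enum_rank a); last by rewrite !mulr0.
    rewrite enum_rankK rmorph_prod; congr (_ * _).
    by apply: eq_bigr => y _; rewrite mxE.
  by rewrite vnormZ ?ltW // vnorm_e mulr1.
have := le_specnorm _ _ x B_le.
rewrite vnorm_Bx vnorm_x -[leLHS](sqr_sqrtr (ltW T_gt0)) expr2.
by rewrite ler_pM2r // sqrtr_gt0.
Qed.

Lemma specnorm_compound_lt {R : realType} {n k : nat} (A : 'M[R[i]]_n) :
  (0 < k)%N -> (k < n)%N -> A \in unitmx ->
  specnorm (compound k A) <
    Num.sqrt ((n%:R / k%:R) ^+ k) *
    \big[Num.max/0]_(a : ksub n k) \prod_(i in val a) vnorm (col i A).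
Proof.
move=> k_gt0 k_lt_n A_unit; set M := \big[_/_]_(a : _) _.
pose d i := vnorm (col i A).
have d_gt0 i : 0 < d i by rewrite lt_def vnorm_ge0 vnorm_eq0 andbT unitmx_col_neq0.
pose D : 'M[R[i]]_n := diag_mx (\row_i (d i)%:C%C).
(* Rescaling the columns of [A] to unit length reduces the claim to [compound_bound] for [B] and a
   diagonal estimate for [D]. *)
pose B : 'M[R[i]]_n := A *m diag_mx (\row_i (d i)^-1%:C%C).
have A_eq : A = B *m D.
  rewrite -mulmxA mulmx_diag -[LHS]mulmx1; congr (_ *m _).
  by apply/matrixP => i j; rewrite !mxE -rmorphM mulVf ?lt0r_neq0.
have colB i : col i B = (d i)^-1%:C%C *: col i A.
  by apply/matrixP => j l; rewrite mxE /B mul_mx_diag !mxE mulrC.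
have B1 i : vnorm (col i B) = 1.
  by rewrite colB vnormZ ?invr_ge0 ?vnorm_ge0 // mulVf // gt_eqF ?d_gt0.
have B_unit : B \in unitmx by move: A_unit; rewrite A_eq unitmx_mul => /andP[].
have [K [K_ge0 _ K_lt B_le]] := compound_bound B k_gt0 B1.
have M_ge0 : 0 <= M by apply: bigmax_ge_id.
(* Positivity of [M] keeps the inequality strict after multiplying by it; the first [k] indices
   supply one positive product. *)
have M_gt0 : 0 < M.
  pose a : ksub n k := Sub [set i : 'I_n | (i < k)%N]%SET
    (introT eqP (card_ord_lt (ltnW k_lt_n))).
  apply: lt_le_trans (le_bigmax _ _ a).
  by rewrite prodr_gt0 // => i _; apply: d_gt0.
have D_le y : vnorm (compound k D *m y) <= M * vnorm y.
  apply: (vnorm_compound_le _ (fun i => d i ^+ 2)) => // [|a].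
    apply/matrixP => i j; rewrite tr_diag_mx map_diag_mx mulmx_diag !mxE.
    congr (_ *+ _).
    by rewrite /= conjC_real_complex -rmorphM -expr2.
  rewrite prodrXl lerXn2r ?nnegrE ?le_bigmax //.
  by rewrite prodr_ge0 // => i _; apply: ltW.
apply: (@le_lt_trans _ _ (K * M)); last by rewrite ltr_pM2r // K_lt.
apply: specnorm_le => [|y]; first by rewrite mulr_ge0.
rewrite A_eq compound_mulmx -mulmxA (le_trans (B_le _)) // -mulrA.
by rewrite ler_wpM2l.
Qed.

Theorem theorem2p6 (R : realType) (n k : nat) :
  (0 < k)%N -> (k <= n)%N ->
  [/\ (forall B : 'M[R[i]]_n, (forall i, vnorm (col i B) = 1) ->
         specnorm (compound k B) <= Num.sqrt ((n%:R / k%:R) ^+ k)),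
      (exists2 B : 'M[R[i]]_n, (forall i, vnorm (col i B) = 1) &
         specnorm (compound k B) = Num.sqrt ((n%:R / k%:R) ^+ k))
    & (forall A : 'M[R[i]]_n, A \in unitmx -> (k < n)%N ->
         specnorm (compound k A) <
           Num.sqrt ((n%:R / k%:R) ^+ k) *
           \big[Num.max/0]_(a : ksub n k) \prod_(i in val a) vnorm (col i A))].
Proof.
move=> k_gt0 k_le_n; split=> [B B1||A A_unit k_lt_n].
- have [K [K_ge0 K_le _ B_le]] := compound_bound B k_gt0 B1.
  exact: le_trans (specnorm_le _ _ K_ge0 B_le) K_le.
- have [B [B1 B_diag]] := @unit_columns_tight_frame R n k k_gt0 k_le_n.
  have [K [K_ge0 K_le _ B_le]] := compound_bound B k_gt0 B1.
  exists B => //; apply/le_anti.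
  rewrite (le_trans (specnorm_le _ _ K_ge0 B_le) K_le) /=.
  (* For the extremal [B] the diagonal of [B B^*] is [n/k] on the first [k] indices, so the lower
     bound at that subset meets the upper bound. *)
  pose q (i : 'I_n) : R := if (i < k)%N then n%:R / k%:R else 0.
  pose a : ksub n k :=
    Sub [set i : 'I_n | (i < k)%N]%SET (introT eqP (card_ord_lt k_le_n)).
  have q_prod : \prod_(x in val a) q x = (n%:R / k%:R) ^+ k.
    rewrite -[X in _ ^+ X](eqP (valP a)) -prodr_const; apply: eq_bigr => x.
    by rewrite SubK inE /q => ->.
  rewrite -q_prod (le_specnorm_compound B q a K) // q_prod.
  by rewrite exprn_gt0 // divr_gt0 ?ltr0n // (leq_trans k_gt0).
- exact: specnorm_compound_lt.
Qed.
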